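(* Let $(\mathcal C,p,pt)$ be a universe category. Consider the sets $Ob$ and $Mor$ together with the identities, composition, length function $l$, object $pt$, function $ft$, $p$-morphisms, objects $f^*(\Delta)$ and $q$-morphisms described in the context. These data form a C0-system, denoted $CC0(\mathcal C,p)$, and there is exactly one operation $f\mapsto s_f$ on $CC0(\mathcal C,p)$ that makes it into a C-system. The resulting C-system is denoted $CC(\mathcal C,p)$.
   Context: Composition of morphisms is written in diagrammatic order: $f\circ g$ means first $f$, then $g$. **Universe categories.** A universe structure on a morphism $p:\widetilde U\to U$ of a category $\mathcal C$ assigns to every morphism $F:X\to U$ a pull-back square with vertex $(X;F)$ and projections $p_{X,F}:(X;F)\to X$, $Q(F):(X;F)\to\widetilde U$ (so $p_{X,F}\circ F=Q(F)\circ p$). For $f:W\to X$, $g:W\to\widetilde U$ with $f\circ F=g\circ p$, $f*g:W\to (X;F)$ is the unique morphism with $(f*g)\circ p_{X,F}=f$ and $(f*g)\circ Q(F)=g$. For $f:X'\to X$ and $F:X\to U$ put $Q(f,F)=(p_{X',f\circ F}\circ f)*Q(f\circ F):(X';f\circ F)\to(X;F)$. A universe category is a triple $(\mathcal C,p,pt)$ where $p$ is a morphism of $\mathcal C$ equipped with a universe structure and $pt$ is a (chosen) final object of $\mathcal C$. **C0-systems and C-systems.** A C0-system is a (small) category $CC$ with a function $l:Ob(CC)\to\mathbb N$, an object $pt$, a function $ft:Ob(CC)\to Ob(CC)$, for each $X$ a morphism $p_X:X\to ft(X)$, and for each $X$ with $l(X)>0$ and each $f:Y\to ft(X)$ an object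 $f^*(X)$ and a morphism $q(f,X):f^*(X)\to X$, such that: (1) $l^{-1}(0)=\{pt\}$; (2) $l(ft(X))=l(X)-1$ if $l(X)>0$; (3) $ft(pt)=pt$; (4) $pt$ is final; (5) if $l(X)>0$ and $f:Y\to ft(X)$ then $l(f^*(X))>0$, $ft(f^*(X))=Y$ and $p_{f^*(X)}\circ f=q(f,X)\circ p_X$ (this is called a canonical square); (6) if $l(X)>0$ then $Id_{ft(X)}^*(X)=X$ and $q(Id_{ft(X)},X)=Id_X$; (7) if $l(X)>0$, $f:Y\to ft(X)$, $g:Z\to Y$, then $(g\circ f)^*(X)=g^*(f^*(X))$ and $q(g\circ f,X)=q(g,f^*(X))\circ q(f,X)$. A C-system is a C0-system with an operation assigning to each $f:Y\to X$ with $l(X)>0$ a morphism $s_f:Y\to (f\circ p_X)^*(X)$ such that $s_f\circ p_{(f\circ p_X)^*(X)}=Id_Y$, $f=s_f\circ q(f\circ p_X,X)$, and, whenever $X=g^*(Z)$ with $l(Z)>0$ and $g:ft(X)\to ft(Z)$, $s_f=s_{f\circ q(g,Z)}$. **The data.** Define by induction sets $Ob_n=Ob_n(\mathcal C,p)$ and functions $int:Ob_n\to Ob(\mathcal C)$: $Ob_0=\{tt\}$ is a one point set, $int(tt)=pt$; $Ob_{n+1}=\coprod_{A\in Ob_n}Hom_{\mathcal C}(int(A),U)$, $int(A,F)=(int(A);F)$. - $Ob=\coprod_{n\ge0}Ob_n$, with elements written $(n,A)$, $A\in Ob_n$, and $int(n,A)=int(A)$. - $Mor=\coprod_{\Gamma,\Gamma'\in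 Ob}Hom_{\mathcal C}(int(\Gamma),int(\Gamma'))$; an element $(\Gamma,(\Gamma',a))$ is a morphism $\Gamma\to\Gamma'$, and $int(\Gamma,(\Gamma',a))=a$. Identities and composition are those of $\mathcal C$. - $l(n,A)=n$; $pt=(0,tt)$; $ft(n+1,(B,F))=(n,B)$, $ft(0,tt)=(0,tt)$. - $p_{(n+1,(B,F))}$ is the morphism to $(n,B)$ with $int(p_{(n+1,(B,F))})=p_{int(B),F}$; $p_{(0,tt)}=Id$. - For $\Delta=(n+1,(B,F))$ and $f:(m,A)\to(n,B)$: $f^*(\Delta)=(m+1,(A,int(f)\circ F))$, and $q(f,\Delta):f^*(\Delta)\to\Delta$ is the morphism with $int(q(f,\Delta))=Q(int(f),F)$. *)

(* Defs.v *)
From Stdlib Require Import PeanoNat ClassicalEpsilon.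

Set Implicit Arguments.
Unset Strict Implicit.
Unset Printing Implicit Defensive.

(** Sets are rendered as types, and equality of objects and of morphisms is
    Leibniz equality. *)

Record category_data := {
  Ob :> Type;
  Hom : Ob -> Ob -> Type;
  id : forall X, Hom X X;
  comp : forall X Y Z, Hom X Y -> Hom Y Z -> Hom X Z
}.
Arguments Hom {_} _ _.
Arguments id {_} X.
Arguments comp {_ X Y Z} _ _.

(** Diagrammatic order: first [f], then [g]. *)
Notation "f ∘ g" := (comp f g) (at level 40, left associativity).

Record is_category (C : category_data) : Prop := {
  comp_id_l : forall (X Y : C) (f : Hom X Y), id X ∘ f = f;
  comp_id_r : forall (X Y : C) (f : Hom X Y), f ∘ id Y = f;
  comp_assoc : forall (X Y Z T : C) (f : Hom X Y) (g : Hom Y Z) (h : Hom Z T),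
    (f ∘ g) ∘ h = f ∘ (g ∘ h)
}.

Record category := {
  cat_data :> category_data;
  cat_laws : is_category cat_data
}.

(** The set of all morphisms.  Two morphisms whose domains or codomains are not
    convertible are compared as elements of [Mor]. *)
Definition Mor (C : category_data) : Type := {X : C & {Y : C & Hom X Y}}.

Definition mor (C : category_data) (X Y : C) (f : Hom X Y) : Mor C :=
  existT _ X (existT _ Y f).

(** The morphism [f] itself, regarded as a morphism to [Y'] when [Y = Y']. *)
Definition cast_cod (C : category_data) (X Y Y' : C) (e : Y = Y')
    (f : Hom X Y) : Hom X Y' :=
  eq_rect Y (fun Z => Hom X Z) f Y' e.

Definition is_final (C : category_data) (T : C) : Prop :=
  forall X : C, exists! f : Hom X T, True.

(** The square with sides [a ∘ F = b ∘ p] is a pull-back square. *)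
Definition is_pullback (C : category_data) (P X V U : C)
    (a : Hom P X) (F : Hom X U) (b : Hom P V) (p : Hom V U) : Prop :=
  a ∘ F = b ∘ p /\
  forall (W : C) (f : Hom W X) (g : Hom W V), f ∘ F = g ∘ p ->
    exists! h : Hom W P, h ∘ a = f /\ h ∘ b = g.

(** ** Universe categories *)

Record universe_structure (C : category_data) (Ut U : C) (p : Hom Ut U) := {
  ext_ob : forall X : C, Hom X U -> C;
  ext_proj : forall (X : C) (F : Hom X U), Hom (ext_ob F) X;
  ext_Q : forall (X : C) (F : Hom X U), Hom (ext_ob F) Ut;
  ext_pullback : forall (X : C) (F : Hom X U),
    is_pullback (ext_proj F) F (ext_Q F) p
}.

Record universe_category := {
  uc_cat :> category;
  uc_Ut : uc_cat;
  uc_U : uc_cat;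
  uc_p : Hom uc_Ut uc_U;
  uc_str : universe_structure uc_p;
  uc_pt : uc_cat;
  uc_pt_final : is_final uc_pt
}.

Section UniverseCategory.
Variable C : universe_category.
Local Notation U := (uc_U C).
Local Notation Ut := (uc_Ut C).

(** [(X;F)], [p_{X,F}] and [Q(F)] *)
Definition ext (X : C) (F : Hom X U) : C := ext_ob (uc_str C) F.
Definition proj (X : C) (F : Hom X U) : Hom (ext F) X := ext_proj (uc_str C) F.
Definition Q (X : C) (F : Hom X U) : Hom (ext F) Ut := ext_Q (uc_str C) F.

(** [f * g] *)
Definition pair (W X : C) (F : Hom X U) (f : Hom W X) (g : Hom W Ut)
    (e : f ∘ F = g ∘ uc_p C) : Hom W (ext F) :=
  proj1_sig (constructive_definite_description _
    (proj2 (ext_pullback (uc_str C) F) W f g e)).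

Lemma Q2_comm (X' X : C) (f : Hom X' X) (F : Hom X U) :
  (proj (f ∘ F) ∘ f) ∘ F = Q (f ∘ F) ∘ uc_p C.
Proof.
  rewrite (comp_assoc (cat_laws C)).
  exact (proj1 (ext_pullback (uc_str C) (f ∘ F))).
Qed.

(** [Q(f,F)] *)
Definition Q2 (X' X : C) (f : Hom X' X) (F : Hom X U) :
    Hom (ext (f ∘ F)) (ext F) :=
  pair (Q2_comm f F).

End UniverseCategory.

(** ** C0-systems and C-systems *)

Record C0_data := {
  c0_cat :> category_data;
  l : c0_cat -> nat;
  pt : c0_cat;
  ft : c0_cat -> c0_cat;
  pr : forall X : c0_cat, Hom X (ft X);
  star : forall X : c0_cat, 0 < l X -> forall Y : c0_cat, Hom Y (ft X) -> c0_cat;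
  q : forall (X : c0_cat) (hX : 0 < l X) (Y : c0_cat) (f : Hom Y (ft X)),
    Hom (star hX f) X
}.
Arguments l {_} _.
Arguments pt {_}.
Arguments ft {_} _.
Arguments pr {_} X.
Arguments star {_ X} hX {Y} f.
Arguments q {_ X} hX {Y} f.

Record is_C0_system (CC : C0_data) : Prop := {
  c0_category : is_category CC;
  l_zero : forall X : CC, l X = 0 <-> X = pt;
  l_ft : forall X : CC, 0 < l X -> l (ft X) = l X - 1;
  ft_pt : ft pt = pt :> CC;
  pt_final : is_final (pt : CC);
  l_star : forall (X : CC) (hX : 0 < l X) (Y : CC) (f : Hom Y (ft X)),
    0 < l (star hX f);
  ft_star : forall (X : CC) (hX : 0 < l X) (Y : CC) (f : Hom Y (ft X)),
    ft (star hX f) = Y;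
  canonical_square :
    forall (X : CC) (hX : 0 < l X) (Y : CC) (f : Hom Y (ft X)),
    cast_cod (ft_star hX f) (pr (star hX f)) ∘ f = q hX f ∘ pr X;
  star_id : forall (X : CC) (hX : 0 < l X), star hX (id (ft X)) = X;
  q_id : forall (X : CC) (hX : 0 < l X), mor (q hX (id (ft X))) = mor (id X);
  star_comp : forall (X : CC) (hX : 0 < l X) (Y : CC) (f : Hom Y (ft X))
      (Z : CC) (g : Hom Z Y),
    star hX (g ∘ f)
    = star (l_star hX f) (cast_cod (eq_sym (ft_star hX f)) g);
  q_comp : forall (X : CC) (hX : 0 < l X) (Y : CC) (f : Hom Y (ft X))
      (Z : CC) (g : Hom Z Y),
    mor (q hX (g ∘ f))
    = mor (q (l_star hX f) (cast_cod (eq_sym (ft_star hX f)) g) ∘ q hX f)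
}.

(** Type of the operations [f |-> s_f]. *)
Definition s_operation (CC : C0_data) : Type :=
  forall (X : CC) (hX : 0 < l X) (Y : CC) (f : Hom Y X),
    Hom Y (star hX (f ∘ pr X)).

Record is_C_system (CC : C0_data) (s : s_operation CC) : Prop := {
  c_C0_system : is_C0_system CC;
  s_section : forall (X : CC) (hX : 0 < l X) (Y : CC) (f : Hom Y X),
    mor (s X hX Y f ∘ pr (star hX (f ∘ pr X))) = mor (id Y);
  s_q : forall (X : CC) (hX : 0 < l X) (Y : CC) (f : Hom Y X),
    f = s X hX Y f ∘ q hX (f ∘ pr X);
  s_star : forall (X : CC) (hX : 0 < l X) (Y : CC) (f : Hom Y X)
      (Z : CC) (hZ : 0 < l Z) (g : Hom (ft X) (ft Z)) (e : X = star hZ g),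
    mor (s X hX Y f) = mor (s Z hZ Y (cast_cod e f ∘ q hZ g))
}.

(** ** The data of [CC0(C,p)] *)

Section CC0.
Variable C : universe_category.
Local Notation U := (uc_U C).

(** [Ob_n] and [int : Ob_n -> Ob(C)], by simultaneous recursion on [n]. *)
Fixpoint Ob_int (n : nat) : {A : Type & A -> C} :=
  match n with
  | 0 => existT (fun A => A -> C) unit (fun _ => uc_pt C)
  | S n =>
      existT (fun A => A -> C)
        {A : projT1 (Ob_int n) & Hom (projT2 (Ob_int n) A) U}
        (fun AF => ext (projT2 AF))
  end.

Definition Obn (n : nat) : Type := projT1 (Ob_int n).
Definition intn (n : nat) : Obn n -> C := projT2 (Ob_int n).

Definition CC_Ob : Type := {n : nat & Obn n}.
Definition int (Γ : CC_Ob) : C := intn (projT2 Γ).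

Definition CC_cat : category_data := {|
  Ob := CC_Ob;
  Hom := fun Γ Γ' => Hom (int Γ) (int Γ');
  id := fun Γ => id (int Γ);
  comp := fun Γ Γ' Γ'' f g => f ∘ g
|}.

Definition CC_l (Γ : CC_cat) : nat := projT1 Γ.

Definition CC_pt : CC_cat := existT Obn 0 tt.

(** The object [(n+1,(B,F))]. *)
Definition CC_ext (n : nat) (B : Obn n) (F : Hom (intn B) U) : CC_cat :=
  existT Obn (S n) (existT (fun A : Obn n => Hom (intn A) U) B F).

Definition CC_ft (Γ : CC_cat) : CC_cat :=
  match Γ with
  | existT _ 0 _ => CC_pt
  | existT _ (S n) BF => existT Obn n (projT1 BF)
  end.

Definition CC_pr (Γ : CC_cat) : Hom Γ (CC_ft Γ) :=
  match Γ return @Hom CC_cat Γ (CC_ft Γ) with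
  | existT _ 0 _ => id (uc_pt C)
  | existT _ (S n) BF => proj (projT2 BF)
  end.

Definition CC_star (Δ : CC_cat) :
    0 < CC_l Δ -> forall Γ : CC_cat, @Hom CC_cat Γ (CC_ft Δ) -> CC_cat :=
  match Δ return
    0 < CC_l Δ -> forall Γ : CC_cat, @Hom CC_cat Γ (CC_ft Δ) -> CC_cat
  with
  | existT _ 0 _ => fun h => False_rect _ (Nat.nlt_0_r 0 h)
  | existT _ (S n) BF => fun _ Γ f =>
      @CC_ext (projT1 Γ) (projT2 Γ)
        (@comp C (int Γ) (intn (projT1 BF)) U f (projT2 BF))
  end.

Definition CC_q (Δ : CC_cat) :
    forall (hΔ : 0 < CC_l Δ) (Γ : CC_cat) (f : @Hom CC_cat Γ (CC_ft Δ)),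
      @Hom CC_cat (CC_star hΔ f) Δ :=
  match Δ return
    forall (hΔ : 0 < CC_l Δ) (Γ : CC_cat) (f : @Hom CC_cat Γ (CC_ft Δ)),
      @Hom CC_cat (CC_star hΔ f) Δ
  with
  | existT _ 0 _ => fun h => False_rect _ (Nat.nlt_0_r 0 h)
  | existT _ (S n) BF => fun _ Γ f => @Q2 C (int Γ) (intn (projT1 BF)) f (projT2 BF)
  end.

Definition CC0 : C0_data := {|
  c0_cat := CC_cat;
  l := CC_l;
  pt := CC_pt;
  ft := CC_ft;
  pr := CC_pr;
  star := CC_star;
  q := CC_q
|}.

End CC0.

(* Main.v *)
Require Import Defs.
From Stdlib Require Import PeanoNat ClassicalEpsilon Eqdep FunctionalExtensionality.

Set Implicit Arguments.
Unset Strict Implicit.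
Unset Printing Implicit Defensive.

(** A morphism into [(X;F)] is determined by its composites with [p_{X,F}] and
    [Q(F)] ([ext_hom_eq]).  For [Q(f,F)] these are [p_{X',f∘F} ∘ f] and
    [Q(f∘F)], and the identity and composition laws for [q] follow by comparing
    composites.  In [CC0] the canonical
    square over [f] is moreover the left half of a rectangle

      [(Y;f∘F) --Q(f,F)--> (X;F) --Q(F)--> Ut]

    over [Y --f--> X --F--> U], and [Q(f,F) ∘ Q(F) = Q(f∘F)].  Hence a morphism
    into a vertex [(Y;f∘F)] is determined by its composites with the projection
    and with [Q(f,F)] ([canonical_hom_eq]).  The two conditions
    [s_f ∘ p = id] and [s_f ∘ q = f] prescribe exactly these, so [s] is unique;
    for [f : Y -> (X;F)] it has to be the morphism [id * (f ∘ Q(F))].  The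
    remaining axiom, invariance of [s] under base change, holds because this
    formula sees [f] only through [f ∘ Q(F)], and
    [(f ∘ Q(g,F)) ∘ Q(F) = f ∘ Q(g∘F)].

    The other difficulty is that equations such as [id∘F = F] hold only
    propositionally, so that the vertices [(X;id∘F)] and [(X;F)] are different
    terms and the morphisms at issue have different types.  The lemmas
    [mor_to_ext_eq] and [mor_Q2_eq] deal with this once and for all, by letting
    the morphism to [U] vary along an equation. *)

(** * Morphisms into [(X;F)] *)

Section Universe.
Variable C : universe_category.
Local Notation U := (uc_U C).
Local Notation Ut := (uc_Ut C).

Lemma ext_square (X : C) (F : Hom X U) : proj F ∘ F = Q F ∘ uc_p C.
Proof. exact (proj1 (ext_pullback (uc_str C) F)). Qed.

Lemma pair_proj (W X : C) (F : Hom X U) (f : Hom W X) (g : Hom W Ut)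
    (e : f ∘ F = g ∘ uc_p C) : pair e ∘ proj F = f.
Proof.
  unfold pair; destruct (constructive_definite_description _ _) as [h [h1 h2]].
  exact h1.
Qed.

Lemma pair_Q (W X : C) (F : Hom X U) (f : Hom W X) (g : Hom W Ut)
    (e : f ∘ F = g ∘ uc_p C) : pair e ∘ Q F = g.
Proof.
  unfold pair; destruct (constructive_definite_description _ _) as [h [h1 h2]].
  exact h2.
Qed.

Lemma ext_hom_eq (W X : C) (F : Hom X U) (h k : Hom W (ext F)) :
  h ∘ proj F = k ∘ proj F -> h ∘ Q F = k ∘ Q F -> h = k.
Proof.
  intros e1 e2.
  assert (e : (k ∘ proj F) ∘ F = (k ∘ Q F) ∘ uc_p C).
  { rewrite !(comp_assoc (cat_laws C)), ext_square; reflexivity. }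
  destruct (proj2 (ext_pullback (uc_str C) F) _ _ _ e) as [m [_ Hm]].
  transitivity m; [symmetry|]; apply Hm; split; trivial.
Qed.

Lemma Q2_proj (X' X : C) (f : Hom X' X) (F : Hom X U) :
  Q2 f F ∘ proj F = proj (f ∘ F) ∘ f.
Proof. apply pair_proj. Qed.

Lemma Q2_Q (X' X : C) (f : Hom X' X) (F : Hom X U) : Q2 f F ∘ Q F = Q (f ∘ F).
Proof. apply pair_Q. Qed.

Lemma Q2_comp_proj (X'' X' X : C) (f : Hom X' X) (g : Hom X'' X')
    (F : Hom X U) :
  (Q2 g (f ∘ F) ∘ Q2 f F) ∘ proj F = proj (g ∘ (f ∘ F)) ∘ (g ∘ f).
Proof.
  rewrite (comp_assoc (cat_laws C)), Q2_proj.
  rewrite <- (comp_assoc (cat_laws C) (Q2 g (f ∘ F))), Q2_proj.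
  apply (comp_assoc (cat_laws C)).
Qed.

Lemma Q2_comp_Q (X'' X' X : C) (f : Hom X' X) (g : Hom X'' X') (F : Hom X U) :
  (Q2 g (f ∘ F) ∘ Q2 f F) ∘ Q F = Q (g ∘ (f ∘ F)).
Proof. rewrite (comp_assoc (cat_laws C)), !Q2_Q; reflexivity. Qed.

(** The uniqueness part of the statement that canonical squares are pull-back
    squares: [Q(f∘F)] factors through [Q(f,F)]. *)
Lemma canonical_hom_eq (W X' X : C) (f : Hom X' X) (F : Hom X U)
    (h k : Hom W (ext (f ∘ F))) :
  h ∘ proj (f ∘ F) = k ∘ proj (f ∘ F) -> h ∘ Q2 f F = k ∘ Q2 f F -> h = k.
Proof.
  intros e1 e2; apply ext_hom_eq; [exact e1|].
  rewrite <- Q2_Q, <- !(comp_assoc (cat_laws C)), e2; reflexivity.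
Qed.

Lemma section_comm (Y X : C) (F : Hom X U) (f : Hom Y (ext F)) :
  id Y ∘ ((f ∘ proj F) ∘ F) = (f ∘ Q F) ∘ uc_p C.
Proof.
  rewrite (comp_id_l (cat_laws C)), !(comp_assoc (cat_laws C)), ext_square.
  reflexivity.
Qed.

(** The morphism [s_f = id * (f ∘ Q(F))]. *)
Definition section (Y X : C) (F : Hom X U) (f : Hom Y (ext F)) :
    Hom Y (ext ((f ∘ proj F) ∘ F)) :=
  pair (section_comm f).

Lemma section_proj (Y X : C) (F : Hom X U) (f : Hom Y (ext F)) :
  section f ∘ proj ((f ∘ proj F) ∘ F) = id Y.
Proof. apply pair_proj. Qed.

Lemma section_Q (Y X : C) (F : Hom X U) (f : Hom Y (ext F)) :
  section f ∘ Q ((f ∘ proj F) ∘ F) = f ∘ Q F.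
Proof. apply pair_Q. Qed.

Lemma section_Q2 (Y X : C) (F : Hom X U) (f : Hom Y (ext F)) :
  section f ∘ Q2 (f ∘ proj F) F = f.
Proof.
  apply ext_hom_eq; rewrite (comp_assoc (cat_laws C)).
  - rewrite Q2_proj, <- (comp_assoc (cat_laws C)), section_proj.
    apply (comp_id_l (cat_laws C)).
  - rewrite Q2_Q; apply section_Q.
Qed.

End Universe.

(** * Comparing morphisms of [CC0] along equations *)

Lemma cast_cod_id (D : category_data) (X Y : D) (e : Y = Y) (f : Hom X Y) :
  cast_cod e f = f.
Proof. rewrite (UIP_refl _ _ e); reflexivity. Qed.

Lemma mor_inj (D : category_data) (X Y : D) (f g : Hom X Y) :
  mor f = mor g -> f = g.
Proof. intro e; apply inj_pair2, inj_pair2 in e; exact e. Qed.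

Section Data.
Variable C : universe_category.
Local Notation U := (uc_U C).

Lemma CC_ext_inj (n : nat) (B : Obn C n) (F G : Hom (intn B) U) :
  CC_ext F = CC_ext G -> F = G.
Proof. intro e; apply inj_pair2, inj_pair2 in e; exact e. Qed.

Lemma mor_to_ext_eq (Γ : CC_cat C) (n : nat) (B : Obn C n)
    (F G : Hom (intn B) U)
    (a : @Hom (CC_cat C) Γ (CC_ext F)) (b : @Hom (CC_cat C) Γ (CC_ext G)) :
  F = G ->
  @comp C _ _ _ a (proj F) = @comp C _ _ _ b (proj G) ->
  @comp C _ _ _ a (Q F) = @comp C _ _ _ b (Q G) ->
  mor a = mor b.
Proof.
  intros e; destruct e; intros e1 e2.
  f_equal; exact (ext_hom_eq e1 e2).
Qed.

(** [Q(f,F)] is recognized by its two composites even when its domain is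
    presented as [(X;G)] for another expression [G] of [f ∘ F]. *)
Lemma mor_Q2_eq (m : nat) (A : Obn C m) (n : nat) (B : Obn C n)
    (f : Hom (intn A) (intn B)) (F : Hom (intn B) U) (G : Hom (intn A) U)
    (h : @Hom (CC_cat C) (CC_ext G) (CC_ext F)) :
  f ∘ F = G ->
  @comp C _ _ _ h (proj F) = proj G ∘ f ->
  @comp C _ _ _ h (Q F) = Q G ->
  @mor (CC_cat C) (CC_ext (f ∘ F)) (CC_ext F) (Q2 f F) = mor h.
Proof.
  intros e; destruct e; intros e1 e2.
  apply mor_to_ext_eq; [reflexivity| |].
  - rewrite e1; apply Q2_proj.
  - rewrite e2; apply Q2_Q.
Qed.

(** * The C0-system *)

Lemma CC_is_category : is_category (CC_cat C).
Proof.
  split; intros.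
  - apply (comp_id_l (cat_laws C)).
  - apply (comp_id_r (cat_laws C)).
  - apply (comp_assoc (cat_laws C)).
Qed.

Lemma CC_l_star (Δ : CC_cat C) (h : 0 < CC_l Δ) (Γ : CC_cat C)
    (f : @Hom (CC_cat C) Γ (CC_ft Δ)) : 0 < CC_l (CC_star h f).
Proof.
  destruct Δ as [[|n] D]; [destruct (Nat.nlt_0_r 0 h)|apply Nat.lt_0_succ].
Qed.

Lemma CC_ft_star (Δ : CC_cat C) (h : 0 < CC_l Δ) (Γ : CC_cat C)
    (f : @Hom (CC_cat C) Γ (CC_ft Δ)) : CC_ft (CC_star h f) = Γ.
Proof.
  destruct Δ as [[|n] D]; [destruct (Nat.nlt_0_r 0 h)|].
  destruct Γ; reflexivity.
Qed.

Lemma CC0_is_C0_system : is_C0_system (CC0 C).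
Proof.
  refine (@Build_is_C0_system (CC0 C) CC_is_category _ _ _ _
    CC_l_star CC_ft_star _ _ _ _ _); simpl.
  - intros [n A]; split; [|intros ->; reflexivity].
    intro e; change (n = 0) in e; subst n; destruct A; reflexivity.
  - intros [[|n] A] h; [destruct (Nat.nlt_0_r 0 h)|].
    symmetry; apply Nat.sub_0_r.
  - reflexivity.
  - intro Γ; exact (uc_pt_final (int Γ)).
  - intros [[|n] BF] h [m A] f; [destruct (Nat.nlt_0_r 0 h)|destruct BF as [B F]].
    rewrite cast_cod_id; symmetry; apply Q2_proj.
  - intros [[|n] BF] h; [destruct (Nat.nlt_0_r 0 h)|destruct BF as [B F]].
    apply (f_equal (@CC_ext C n B)), (comp_id_l (cat_laws C)).
  - intros [[|n] BF] h; [destruct (Nat.nlt_0_r 0 h)|destruct BF as [B F]].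
    apply (@mor_Q2_eq n B n B (id _) F F (id (int (CC_ext F)))).
    + apply (comp_id_l (cat_laws C)).
    + rewrite (comp_id_r (cat_laws C)); apply (comp_id_l (cat_laws C)).
    + apply (comp_id_l (cat_laws C)).
  - intros [[|n] BF] h [m A] f [k D] g; [destruct (Nat.nlt_0_r 0 h)|destruct BF as [B F]].
    rewrite cast_cod_id.
    apply (f_equal (@CC_ext C k D)), (comp_assoc (cat_laws C)).
  - intros [[|n] BF] h [m A] f [k D] g; [destruct (Nat.nlt_0_r 0 h)|destruct BF as [B F]].
    rewrite cast_cod_id.
    apply (@mor_Q2_eq k D n B (@comp C _ _ _ g f) F
             (@comp C _ _ _ g (@comp C _ _ _ f F))
             (@comp C _ _ _ (Q2 g (f ∘ F)) (Q2 f F))).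
    + apply (comp_assoc (cat_laws C)).
    + apply (Q2_comp_proj f g F).
    + apply (Q2_comp_Q f g F).
Qed.

(** * The operation [s] *)

Definition CC_s : s_operation (CC0 C) :=
  fun Δ => match Δ return
    forall (h : 0 < CC_l Δ) (Γ : CC_cat C) (f : @Hom (CC_cat C) Γ Δ),
      @Hom (CC_cat C) Γ (CC_star h (f ∘ CC_pr Δ))
  with
  | existT _ 0 _ => fun h => False_rect _ (Nat.nlt_0_r 0 h)
  | existT _ (S n) BF => fun _ Γ f =>
      @section C (int Γ) (intn (projT1 BF)) (projT2 BF) f
  end.

Lemma CC_s_is_C_system : is_C_system CC_s.
Proof.
  split.
  - exact CC0_is_C0_system.
  - intros [[|n] BF] h [m A] f; [destruct (Nat.nlt_0_r 0 h)|destruct BF as [B F]].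
    apply (f_equal (@mor (CC_cat C) (existT _ m A) (existT _ m A))).
    apply section_proj.
  - intros [[|n] BF] h Γ f; [destruct (Nat.nlt_0_r 0 h)|destruct BF as [B F]].
    symmetry; apply (@section_Q2 C (int Γ) (intn B) F f).
  - intros [[|m] AG] h [k D] f [[|n] BF] hZ g e;
      [destruct (Nat.nlt_0_r 0 h)|destruct (Nat.nlt_0_r 0 h)
      |destruct (Nat.nlt_0_r 0 hZ)|destruct AG as [A G], BF as [B F]].
    (* As g starts at ft X, the equation e cannot be used to replace X by the
       pulled back object; it is used instead to replace G by g ∘ F, once the
       type of g is written without G. *)
    change (@Hom C (intn A) (intn B)) in g.
    pose proof (CC_ext_inj e) as eG; cbn in eG; subst G.
    rewrite cast_cod_id.
    set (fq := @comp C _ _ _ f (Q2 g F)).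
    apply (@mor_to_ext_eq (existT _ k D) k D _ _
             (@section C (intn D) (intn A) _ f)
             (@section C (intn D) (intn B) F fq)).
    + unfold fq; rewrite !(comp_assoc (cat_laws C)).
      rewrite <- (comp_assoc (cat_laws C) (Q2 g F)), Q2_proj.
      rewrite (comp_assoc (cat_laws C)); reflexivity.
    + exact (eq_trans (section_proj _) (eq_sym (section_proj _))).
    + refine (eq_trans (section_Q _) (eq_trans _ (eq_sym (section_Q _)))).
      symmetry; unfold fq; rewrite (comp_assoc (cat_laws C)).
      apply (f_equal (@comp C _ _ _ f)), Q2_Q.
Qed.

Lemma CC_s_unique (s t : s_operation (CC0 C)) :
  is_C_system s -> is_C_system t -> s = t.
Proof.
  intros Hs Ht.
  extensionality Δ; extensionality h; extensionality Γ; extensionality f.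
  pose proof (eq_trans (s_section Hs h f) (eq_sym (s_section Ht h f))) as e1.
  pose proof (eq_trans (eq_sym (s_q Hs h f)) (s_q Ht h f)) as e2.
  apply mor_inj in e1.
  destruct Δ as [[|n] BF]; [destruct (Nat.nlt_0_r 0 h)|destruct BF as [B F]].
  exact (canonical_hom_eq e1 e2).
Qed.

End Data.

Theorem mainTheorem1 (C : universe_category) :
  is_C0_system (CC0 C) /\
  exists! s : s_operation (CC0 C), is_C_system s.
Proof.
  split; [apply CC0_is_C0_system|].
  exists (@CC_s C); split; [apply CC_s_is_C_system|].
  intros t Ht; exact (CC_s_unique (CC_s_is_C_system C) Ht).
Qed.
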